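(* For every $\alpha\in\Pi_l$, there is a one-to-one correspondence between $\min\bigl(I(\alpha)_{\min}\bigr)$ and $\max\bigl(\Delta^+\setminus I(\alpha)_{\max}\bigr)$. Namely, if $\nu\in\min\bigl(I(\alpha)_{\min}\bigr)$, then $\theta-\nu\in\max\bigl(\Delta^+\setminus I(\alpha)_{\max}\bigr)$; and vice versa, if $\eta\in\max\bigl(\Delta^+\setminus I(\alpha)_{\max}\bigr)$, then $\theta-\eta\in\min\bigl(I(\alpha)_{\min}\bigr)$. In particular, $\max\bigl(\Delta^+\setminus I(\alpha)_{\max}\bigr)\subset\mathcal H$.
   Context: Let $\mathfrak g$ be a complex simple Lie algebra with triangular decomposition $\mathfrak g=\mathfrak u\oplus\mathfrak t\oplus\mathfrak u^-$, Borel subalgebra $\mathfrak b=\mathfrak u\oplus\mathfrak t$, root system $\Delta$ of $(\mathfrak g,\mathfrak t)$, positive roots $\Delta^+$ (corresponding to $\mathfrak u$), simple roots $\Pi=\{\alpha_1,\dots,\alpha_n\}$, highest root $\theta$, Weyl group $W$, and $W$-invariant inner product $(\ ,\ )$ on $V=\bigoplus_i\mathbb R\alpha_i$. $\Delta^+_l$ is the set of long positive roots (all roots are long in the simply-laced case), $\Pi_l=\Pi\cap\Delta^+_l$, and $\mathcal H=\{\gamma\in\Delta^+\mid(\gamma,\theta)\ne0\}$. Root order on $\Delta^+$: $\mu\preccurlyeq\nu$ iff $\nu-\mu$ is a non-negative integral combination of simple roots. For $\mathcal S\subset\Delta^+$, $\min(\mathcal S)$ and $\max(\mathcal S)$ denote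 the sets of minimal and maximal elements of $\mathcal S$ with respect to $\preccurlyeq$. Abelian ideals: $\mathfrak{Ab}$ is the poset (under inclusion) of subspaces $\mathfrak a\subset\mathfrak u$ with $[\mathfrak b,\mathfrak a]\subset\mathfrak a$ and $[\mathfrak a,\mathfrak a]=0$. Each is a sum of root spaces and is identified with the corresponding set $I\subset\Delta^+$, which is an upper ideal of $(\Delta^+,\preccurlyeq)$ with no two elements summing to a root. Minuscule elements: let $\widehat V=V\oplus\mathbb R\delta\oplus\mathbb R\lambda$, with the inner product extended by $(\delta,V)=(\lambda,V)=(\delta,\delta)=(\lambda,\lambda)=0$, $(\delta,\lambda)=1$; $\alpha_0=\delta-\theta$; $\mu^\vee=2\mu/(\mu,\mu)$; $s_i(x)=x-(x,\alpha_i)\alpha_i^\vee$ for $0\le i\le n$; $\widehat W=\langle s_0,\dots,s_n\rangle\subset GL(\widehat V)$; $\widehat\Delta^+=\Delta^+\cup\{\gamma+k\delta\mid\gamma\in\Delta,\ k\ge1\}$; $\mathcal N(w)=\{\nu\in\widehat\Delta^+\mid w(\nu)\in-\widehat\Delta^+\}$. An element $w\in\widehat W$ is minuscule if $\mathcal N(w)=\{\delta-\gamma\mid\gamma\in I_w\}$ for some $I_w\subset\Delta$. Then $I_w$ is an abelian ideal and $w\mapsto I_w$ is a bijection from minuscule elements onto $\mathfrak{Ab}$; write $w_I$ for the element corresponding to $I$. Rootlets: for a nonzero abelian ideal $I$, the rootlet is $\mathrm{rt}(I)=w_I(2\delta-\theta)$, which lies in $\Delta^+_l$. For $\mu\in\Delta^+_l$,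 $\mathfrak{Ab}_\mu$ is the set of nonzero abelian ideals with rootlet $\mu$. It is known that $\mathfrak{Ab}_\mu$ is nonempty and has a unique minimal element $I(\mu)_{\min}$ and a unique maximal element $I(\mu)_{\max}$, regarded as subsets of $\Delta^+$.
   Formalization: The one-to-one correspondence and the direction from ν to θ−ν are stated for rank at least 2 only, since for sl_2 one has I(α)_min = I(α)_max = Δ^+ = {θ}, so the first set is {θ} and the second is empty. *)

(* Defs.v *)
From HB Require Import structures.
From mathcomp Require Import all_boot all_order all_algebra.
From mathcomp Require Import boolp classical_sets functions cardinality reals.
Import Order.TTheory GRing.Theory Num.Theory.

Set Implicit Arguments.
Unset Strict Implicit.
Unset Printing Implicit Defensive.

Local Open Scope classical_set_scope.
Local Open Scope ring_scope.

(* A complex simple Lie algebra with a Cartan subalgebra and a triangular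
   decomposition is represented by its combinatorial data: an irreducible
   reduced crystallographic root system [Delta] spanning a Euclidean space
   [V], with a base [Pi] (an n-tuple, which is a basis of [V]).  Abelian ideals
   are the corresponding subsets of the set of positive roots. *)

Section RootSystems.
Context {R : realType} {V : vectType R} (dot : {dot V for idfun}).
Implicit Types (Delta S I A B : set V) (x y mu nu gamma : V).

Definition coroot mu : V := (2 / dot mu mu) *: mu.

Definition reflection mu x : V := x - dot x mu *: coroot mu.

(* The inner product is then automatically invariant under the Weyl group,
   which is generated by the (orthogonal) reflections of [V]. *)
Record is_root_system Delta : Prop := IsRootSystem {
  rs_finite : finite_set Delta;
  rs_span : forall U : {vspace V},
    (forall gamma, Delta gamma -> gamma \in U) -> U = fullv;
  rs_neq0 : ~ Delta 0;
  rs_reflection : forall mu gamma,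
    Delta mu -> Delta gamma -> Delta (reflection mu gamma);
  rs_integral : forall mu gamma, Delta mu -> Delta gamma ->
    exists m : int, dot gamma (coroot mu) = m%:~R;
  rs_reduced : forall (c : R) mu,
    Delta mu -> Delta (c *: mu) -> c = 1 \/ c = -1 }.

Definition is_irreducible Delta : Prop :=
  Delta !=set0 /\
  forall A B, A `|` B = Delta ->
    (forall x y, A x -> B y -> dot x y = 0) -> A = set0 \/ B = set0.

Section Base.
Context {n : nat} (Pi : n.-tuple V).

Definition nat_comb x : Prop :=
  exists c : 'I_n -> nat, x = \sum_(i < n) tnth Pi i *+ c i.

Definition is_base Delta : Prop :=
  [/\ basis_of fullv Pi,
      forall i, Delta (tnth Pi i) &
      forall gamma, Delta gamma -> nat_comb gamma \/ nat_comb (- gamma)].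

Definition positive_roots Delta : set V :=
  [set gamma | Delta gamma /\ nat_comb gamma].

Definition root_le mu nu : Prop := nat_comb (nu - mu).

Definition min_elts S : set V :=
  [set mu | S mu /\ forall nu, S nu -> root_le nu mu -> nu = mu].

Definition max_elts S : set V :=
  [set mu | S mu /\ forall nu, S nu -> root_le mu nu -> nu = mu].

Definition is_highest_root Delta theta : Prop :=
  positive_roots Delta theta /\
  forall gamma, positive_roots Delta gamma -> root_le gamma theta.

Definition is_long Delta mu : Prop :=
  Delta mu /\ forall gamma, Delta gamma -> dot gamma gamma <= dot mu mu.

Definition Hset Delta theta : set V :=
  [set gamma | positive_roots Delta gamma /\ dot gamma theta <> 0].

Definition abelian_ideal Delta I : Prop :=
  [/\ I `<=` positive_roots Delta,
      forall gamma nu, I gamma -> positive_roots Delta nu ->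
        root_le gamma nu -> I nu &
      forall gamma nu, I gamma -> I nu -> ~ Delta (gamma + nu)].

(* [((x, k), l)] stands for x + k delta + l lambda. *)
Definition hatV : lmodType R := (V * R^o * R^o)%type.

Definition emb x : hatV := (x, 0, 0).
Definition delta : hatV := (0, 1, 0).

Definition hat_dot (x y : hatV) : R :=
  dot x.1.1 y.1.1 + x.1.2 * y.2 + x.2 * y.1.2.

Definition hat_coroot (a : hatV) : hatV := (2 / hat_dot a a) *: a.

Definition hat_reflection (a x : hatV) : hatV :=
  x - hat_dot x a *: hat_coroot a.

(* [None] is the index 0 of the affine simple root delta - theta. *)
Definition affine_simple theta (i : option 'I_n) : hatV :=
  if i is Some j then emb (tnth Pi j) else delta - emb theta.

(* The subgroup of GL(hatV) generated by the simple reflections. *)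
Inductive affine_weyl theta : (hatV -> hatV) -> Prop :=
| affine_weyl_id : affine_weyl theta idfun
| affine_weyl_gen i :
    affine_weyl theta (hat_reflection (affine_simple theta i))
| affine_weyl_comp v w :
    affine_weyl theta v -> affine_weyl theta w -> affine_weyl theta (v \o w)
| affine_weyl_inv v w :
    affine_weyl theta v -> cancel v w -> cancel w v -> affine_weyl theta w.

Definition affine_positive Delta : set hatV :=
  emb @` positive_roots Delta `|`
  [set x | exists gamma (k : nat),
     [/\ Delta gamma, (1 <= k)%N & x = emb gamma + delta *+ k]].

Definition inversions Delta (w : hatV -> hatV) : set hatV :=
  [set nu | affine_positive Delta nu /\ affine_positive Delta (- w nu)].

(* [w] is a minuscule element and [I] is the set I_w. *)
Definition minuscule_for Delta theta I (w : hatV -> hatV) : Prop :=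
  [/\ affine_weyl theta w, I `<=` Delta &
      inversions Delta w = [set delta - emb gamma | gamma in I]].

(* rt(I) = mu; the minuscule element w_I is determined by I. *)
Definition has_rootlet Delta theta I mu : Prop :=
  exists2 w, minuscule_for Delta theta I w &
             w (delta *+ 2 - emb theta) = emb mu.

Definition Ab Delta theta mu : set (set V) :=
  [set I | [/\ abelian_ideal Delta I, I !=set0 & has_rootlet Delta theta I mu]].

End Base.
End RootSystems.

Section UniqueExtremal.
Context {T : Type}.
Implicit Types (F : set (set T)) (I J : set T).

Definition minimal_in F I : Prop := F I /\ forall J, F J -> J `<=` I -> J = I.
Definition maximal_in F I : Prop := F I /\ forall J, F J -> I `<=` J -> J = I.

Definition unique_minimal F I : Prop :=
  minimal_in F I /\ forall J, minimal_in F J -> J = I.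
Definition unique_maximal F I : Prop :=
  maximal_in F I /\ forall J, maximal_in F J -> J = I.

End UniqueExtremal.

(* Main.v *)
Require Import Defs.
From mathcomp Require Import all_boot all_order all_algebra.
From mathcomp Require Import boolp classical_sets functions cardinality reals.
From mathcomp Require Import ring lra zify.
Import Order.TTheory GRing.Theory Num.Theory.
Local Open Scope classical_set_scope.
Local Open Scope ring_scope.

Set Implicit Arguments.
Unset Strict Implicit.
Unset Printing Implicit Defensive.

(** An element [w] of the affine Weyl group maps [x + c delta] to
    [g x + (c + k x) delta], where [g] is an isometry permuting the roots and
    [k] is additive and integral on them.  If [w] is the minuscule element of
    an abelian ideal [I], then [k] takes only the values 0, 1 and 2 on positive
    roots, and [k x] together with the sign of [g x] tells whether [x] lies in
    [I] (lemma [minuscule_shift]).  The rootlet of [I] is the simple root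
    [alpha] iff [g theta = - alpha] and [k theta = 2].  Three facts follow.

    - If [x] and [y] are positive roots with [x + y = theta], exactly one of
      them lies in [I]: as [alpha] is not a sum of two positive roots, [g x] and
      [g y] have opposite signs ([complementary_pair]).
    - If [nu] is minimal in [I] and orthogonal to [theta], then
      [w (delta - nu)] is minus an affine simple root; composing [w] with that
      simple reflection removes [nu] from the ideal and fixes the rootlet
      ([Ab_remove]).  Hence the smallest ideal with rootlet [alpha] lies in H.
    - If [eta] is maximal outside [I], orthogonal to [theta], and has no root as
      sum with an element of [I], then in the same way [eta] can be added to [I]
      ([Ab_add]).

    Now let [Imin] and [Imax] be the extreme ideals with rootlet [alpha], so that
    [Imin] is contained in [Imax].  Having one root from each pair
    [x, theta - x], they have the same roots in H, whence [Imin] is the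
    intersection of [Imax] with H ([dot_gt0_Imin]).  If [eta] is maximal outside
    [Imax], then by the third fact either [eta] is not orthogonal to [theta], so
    that [theta - eta] lies in [Imax] by the first fact, or [eta + gamma] is a
    root for some [gamma] in [Imax]; in the latter case [gamma] can be raised
    inside [Imax] until [eta + gamma = theta] ([max_elt_complement]).  So
    [theta - eta] lies in [Imin] in all cases.  Finally [x |-> theta - x]
    reverses the root order and, by the first fact, exchanges the elements of
    [Imin] other than [theta] with the elements of H outside [Imax], which turns
    minimal elements into maximal ones. *)

(** * Coordinates and heights *)

Section Coordinates.
Context {R : realType} {V : vectType R} {n : nat} (Pi : n.-tuple V).
Context (Pi_basis : basis_of fullv Pi).
Implicit Types x y : V.

Lemma coord_simple i j : coord Pi i (tnth Pi j) = (i == j)%:R.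
Proof.
by rewrite (tnth_nth 0) coord_free ?(basis_free Pi_basis) // eq_sym.
Qed.

Lemma simple_sum x : x = \sum_(i < n) coord Pi i x *: tnth Pi i.
Proof.
rewrite {1}(coord_basis Pi_basis (memvf x)).
by apply: eq_bigr => i _; rewrite (tnth_nth 0).
Qed.

Lemma nat_combP x :
  nat_comb Pi x <-> forall i, exists m : nat, coord Pi i x = m%:R.
Proof.
split=> [[c ->] i|].
  exists (c i); rewrite linear_sum (bigD1 i) //= big1 => [|j ji].
    by rewrite addr0 linearMn /= coord_simple eqxx.
  by rewrite linearMn /= coord_simple eq_sym (negPf ji) mul0rn.
move=> /choice[c cE]; exists c; rewrite [LHS]simple_sum.
by apply: eq_bigr => i _; rewrite cE scaler_nat.
Qed.

Lemma nat_comb0 : nat_comb Pi 0.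
Proof. by apply/nat_combP => i; exists 0; rewrite linear0. Qed.

Lemma nat_combD x y : nat_comb Pi x -> nat_comb Pi y -> nat_comb Pi (x + y).
Proof.
move=> /nat_combP xP /nat_combP yP; apply/nat_combP => i.
have [[a xa] [b yb]] := (xP i, yP i).
by exists (a + b)%N; rewrite linearD /= xa yb natrD.
Qed.

Lemma nat_comb_coord_ge0 x i : nat_comb Pi x -> 0 <= coord Pi i x.
Proof. by move=> /nat_combP /(_ i)[m ->]. Qed.

Lemma nat_comb_simple i : nat_comb Pi (tnth Pi i).
Proof. by apply/nat_combP => j; exists (j == i); rewrite coord_simple. Qed.

Lemma nat_comb_antisym x : nat_comb Pi x -> nat_comb Pi (- x) -> x = 0.
Proof.
move=> xP nxP; rewrite (simple_sum x) big1 // => i _.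
have := nat_comb_coord_ge0 i xP; have := nat_comb_coord_ge0 i nxP.
rewrite linearN /= => h1 h2.
suff -> : coord Pi i x = 0 by rewrite scale0r.
by lra.
Qed.

Definition height x : R := \sum_(i < n) coord Pi i x.

Lemma heightD x y : height (x + y) = height x + height y.
Proof.
by rewrite /height -big_split; apply: eq_bigr => i _; rewrite linearD.
Qed.

Lemma heightN x : height (- x) = - height x.
Proof. by rewrite /height -sumrN; apply: eq_bigr => i _; rewrite linearN. Qed.

Lemma height_simple i : height (tnth Pi i) = 1.
Proof.
rewrite /height (bigD1 i) //= big1 => [|j ji]; rewrite coord_simple.
  by rewrite eqxx addr0.
by rewrite (negPf ji).
Qed.

Lemma height_nat x : nat_comb Pi x -> exists m : nat, height x = m%:R.
Proof.
move=> /nat_combP /choice[c cE]; exists (\sum_(i < n) c i)%N.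
by rewrite natr_sum; apply: eq_bigr.
Qed.

Lemma height_ge1 x : nat_comb Pi x -> x <> 0 -> 1 <= height x.
Proof.
move=> xP x0; have [[|m] hm] := height_nat xP; last by rewrite hm ler1n.
case: x0; rewrite (simple_sum x) big1 // => i _.
move/eqP: hm; rewrite psumr_eq0 => [|j _]; last exact: nat_comb_coord_ge0.
by move/allP/(_ i (mem_index_enum i))/eqP ->; rewrite scale0r.
Qed.

Lemma root_le_antisym x y : root_le Pi x y -> root_le Pi y x -> x = y.
Proof.
rewrite /root_le => xy yx; apply/eqP; rewrite -subr_eq0; apply/eqP.
by apply: nat_comb_antisym => //; rewrite opprB.
Qed.

End Coordinates.

(** * Roots, the highest root and the root order *)

Section RootSystem.
Context {R : realType} {V : vectType R} (dot : {dot V for idfun}).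
Context {n : nat} (Pi : n.-tuple V) (Delta : set V).
Context (Delta_rs : is_root_system dot Delta) (Pi_base : is_base Pi Delta).
Implicit Types (x y a b p q gamma : V).

Local Notation P := (positive_roots Pi Delta).

Lemma base_basis : basis_of fullv Pi. Proof. by case: Pi_base. Qed.
Local Notation bP := base_basis.

Lemma dotC x y : dot x y = dot y x.
Proof. by rewrite hermC /= expr0 mul1r. Qed.

Lemma dot_gt0 x : x <> 0 -> 0 < dot x x.
Proof. by move/eqP; exact: neq0_dnorm_gt0. Qed.

Lemma dot_eq0 x : dot x x <= 0 -> x = 0.
Proof. by move=> x0; apply: contrapT => /dot_gt0; lra. Qed.

Lemma root_neq0 x : Delta x -> x <> 0.
Proof. by move=> xD x0; apply: (rs_neq0 Delta_rs); rewrite -x0. Qed.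

Lemma dot_coroot x y : dot x (coroot dot y) = 2 * dot x y / dot y y.
Proof. by rewrite /coroot linearZr /=; ring. Qed.

Lemma reflection_self x : x <> 0 -> reflection dot x x = - x.
Proof.
move=> x0; have := dot_gt0 x0 => xx.
rewrite /reflection /coroot scalerA -[X in X - _]scale1r -scalerBl -scaleN1r.
by congr (_ *: _); field; exact: lt0r_neq0.
Qed.

Lemma rootN x : Delta x -> Delta (- x).
Proof.
by move=> xD; rewrite -(reflection_self (root_neq0 xD)); exact: rs_reflection.
Qed.

Lemma double_not_root x : Delta x -> ~ Delta (x + x).
Proof.
move=> xD; rewrite -mulr2n -scaler_nat => /(rs_reduced Delta_rs xD).
by case; lra.
Qed.

(** If neither Cartan integer were [-1], both would be at most [-2], and then
    the squared norm of [x + y] would be at most [0]; when one of them is [-1]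
    the sum is a reflection of [x] or [y]. *)
Lemma root_add x y :
  Delta x -> Delta y -> dot x y < 0 -> x + y <> 0 -> Delta (x + y).
Proof.
move=> xD yD xy xy0.
have [xx yy] := (dot_gt0 (root_neq0 xD), dot_gt0 (root_neq0 yD)).
have small a b m : 0 < dot b b -> dot a b < 0 -> dot a (coroot dot b) = m%:~R ->
  m = -1 \/ dot a b <= - dot b b.
  move=> bb ab; rewrite dot_coroot => mE.
  have mE' : 2 * dot a b = m%:~R * dot b b by rewrite -mE; field; lra.
  case: (lerP m (-2)) => [m2|m2].
    right; have : m%:~R <= (-2) :> R by rewrite (ler_int _ _ (-2)).
    by nra.
  left; suff : m < 0 by lia.
  by rewrite -(ltrz0 R); nra.
have [m1 m1E] := rs_integral Delta_rs yD xD.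
have [m2 m2E] := rs_integral Delta_rs xD yD.
have refl a b : dot a (coroot dot b) = (-1)%:~R -> 0 < dot b b ->
    reflection dot b a = a + b.
  rewrite dot_coroot /reflection /coroot scalerA => ab bb; congr (_ + _).
  rewrite -[RHS]scale1r -scaleNr; congr (_ *: _).
  by rewrite mulrA [dot a b * 2]mulrC ab; ring.
case: (small _ _ _ yy xy m1E) => [m1N|h1].
  by rewrite -refl ?m1E ?m1N //; exact: rs_reflection.
have yx : dot y x < 0 by rewrite dotC.
case: (small _ _ _ xx yx m2E) => [m2N|h2].
  by rewrite addrC -refl ?m2E ?m2N //; exact: rs_reflection.
case: xy0; apply: dot_eq0.
by rewrite linearDl !linearDr /=; move: h2; rewrite dotC; lra.
Qed.

Lemma root_sub x y :
  Delta x -> Delta y -> 0 < dot x y -> x <> y -> Delta (x - y).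
Proof.
move=> xD yD xy xney; apply: root_add => //; first exact: rootN.
  by rewrite linearNr /=; lra.
by move/eqP; rewrite subr_eq0 => /eqP.
Qed.

(** The root-system shadow of the Jacobi identity: pairing [r = a + b + c] with
    itself, either [b] or [c] can be removed from [r], or else [a] has negative
    product with [b + c] and hence with [b] or [c]. *)
Lemma root_jacobi a b c :
  Delta a -> Delta b -> Delta c -> Delta (a + b + c) ->
  a + b <> 0 -> a + c <> 0 -> b + c <> 0 ->
  Delta (a + b) \/ Delta (a + c).
Proof.
move=> aD bD cD rD ab0 ac0 bc0; set r := a + b + c in rD.
have rc : r - c = a + b by rewrite addrK.
have rb : r - b = a + c by rewrite /r addrAC addrK.
case: (ltrP 0 (dot r b)) => [h|hb].
  right; rewrite -rb; apply: root_sub => // E.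
  by apply: ac0; rewrite -rb E subrr.
case: (ltrP 0 (dot r c)) => [h|hc].
  left; rewrite -rc; apply: root_sub => // E.
  by apply: ab0; rewrite -rc E subrr.
have := dot_gt0 bc0; rewrite linearDl !linearDr /= => bc.
move: hb hc; rewrite /r !linearDl /= => hb hc.
case: (ltrP (dot a b) 0) => [h|h]; first by left; apply: root_add.
by right; apply: root_add => //; lra.
Qed.

Lemma pos_root x : P x -> Delta x. Proof. by case. Qed.
Lemma pos_comb x : P x -> nat_comb Pi x. Proof. by case. Qed.
Lemma pos_neq0 x : P x -> x <> 0. Proof. by move/pos_root/root_neq0. Qed.

Lemma pos_or_neg x : Delta x -> P x \/ P (- x).
Proof.
case: Pi_base => _ _ dich xD; case: (dich x xD) => ?; first by left.
by right; split=> //; exact: rootN.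
Qed.

Lemma pos_neg_false x : P x -> P (- x) -> False.
Proof.
move=> xP [_ nxP]; apply: (pos_neq0 xP).
by apply: (nat_comb_antisym bP) nxP; case: xP.
Qed.

Lemma simple_pos i : P (tnth Pi i).
Proof.
by case: Pi_base => _ D _; split; [exact: D|exact: nat_comb_simple bP i].
Qed.

Lemma pos_height_ge1 x : P x -> 1 <= height Pi x.
Proof. by move=> xP; apply: (height_ge1 bP (pos_comb xP)); exact: pos_neq0. Qed.

Lemma posD x y : P x -> P y -> Delta (x + y) -> P (x + y).
Proof. by move=> [_ ?] [_ ?] ?; split=> //; exact: (nat_combD bP). Qed.

Lemma pos_sum_neq0 x y : P x -> P y -> x + y <> 0.
Proof.
move=> xP yP /(congr1 (height Pi)); rewrite heightD.
have := pos_height_ge1 xP; have := pos_height_ge1 yP.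
suff -> : height Pi 0 = 0 by lra.
by rewrite /height big1 // => i _; rewrite linear0.
Qed.

Lemma root_le_addr x y : P y -> root_le Pi x (x + y).
Proof. by rewrite /root_le addrAC subrr add0r => -[]. Qed.

Lemma add_pos_neq x y : P y -> x + y <> x.
Proof.
move=> yP /eqP; rewrite -subr_eq0 addrAC subrr add0r => /eqP.
exact: pos_neq0.
Qed.

Lemma root_le_addl x y : P x -> root_le Pi y (x + y).
Proof. by rewrite addrC; exact: root_le_addr. Qed.

Lemma pos_jacobi a b c : P a -> P b -> P c -> Delta (a + b + c) ->
  P (a + b) \/ P (a + c).
Proof.
move=> aP bP' cP D.
have := root_jacobi (pos_root aP) (pos_root bP') (pos_root cP) D.
case; [exact: pos_sum_neq0..| |]; first by left; exact: posD.
by right; exact: posD.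
Qed.

Lemma simple_indecomposable i x y : P x -> P y -> x + y <> tnth Pi i.
Proof.
move=> xP yP /(congr1 (height Pi)); rewrite heightD (height_simple bP).
by have := pos_height_ge1 xP; have := pos_height_ge1 yP; lra.
Qed.

Lemma dot_simple_sum x y :
  dot y x = \sum_(i < n) coord Pi i x * dot y (tnth Pi i).
Proof.
rewrite {1}(simple_sum bP x) linear_sumr /=; apply: eq_bigr => i _.
by rewrite linearZr.
Qed.

(** A positive root [p] has positive product with itself, hence with some
    simple root occurring in it, and that simple root can be subtracted. *)
Lemma pos_decompose p : P p ->
  (exists i, p = tnth Pi i) \/ (exists i q, P q /\ p = tnth Pi i + q).
Proof.
move=> pP; have pp := dot_gt0 (pos_neq0 pP).
have [i pi] : exists i, 0 < dot p (tnth Pi i).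
  apply: contrapT => /forallNP no; suff : dot p p <= 0 by lra.
  rewrite dot_simple_sum; apply: sumr_le0 => i _; apply: mulr_ge0_le0.
    exact/(nat_comb_coord_ge0 bP)/pos_comb.
  by rewrite leNgt; apply/negP => /no.
case: (pselect (p = tnth Pi i)) => [->|pne]; first by left; exists i.
right; exists i, (p - tnth Pi i); split; last by rewrite addrC subrK.
have := root_sub (pos_root pP) (pos_root (simple_pos i)) pi pne.
move=> /pos_or_neg[//|]; rewrite opprB => qP.
by case: (@simple_indecomposable i p (tnth Pi i - p)) => //; rewrite addrC subrK.
Qed.

(** Subtracting a multiple of [alpha_i] leaves the other coefficients of
    [gamma] unchanged, and one of them is positive as the system is reduced. *)
Lemma simple_reflection_pos i gamma : P gamma -> gamma <> tnth Pi i ->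
  P (reflection dot (tnth Pi i) gamma).
Proof.
move=> gP gne.
have := rs_reflection Delta_rs (pos_root (simple_pos i)) (pos_root gP).
move=> /pos_or_neg[//|[_ sC]]; case: gne.
have gE : gamma = coord Pi i gamma *: tnth Pi i.
  rewrite {1}(simple_sum bP gamma) (bigD1 i) //= big1 ?addr0 // => j ji.
  have := nat_comb_coord_ge0 bP j sC; have := nat_comb_coord_ge0 bP j (pos_comb gP).
  rewrite linearN linearB /= /coroot !linearZ /= (coord_simple bP) (negPf ji).
  rewrite !mulr0 subr0 => h1 h2.
  suff -> : coord Pi j gamma = 0 by rewrite scale0r.
  by lra.
have := pos_root gP; rewrite gE => /(rs_reduced Delta_rs (pos_root (simple_pos i))).
case=> [->|c {gE}]; first by rewrite scale1r.
by have := nat_comb_coord_ge0 bP i (pos_comb gP); rewrite c ler0N1.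
Qed.

Section HighestRoot.
Context (theta : V) (theta_highest : is_highest_root Pi Delta theta).

Lemma highest_pos : P theta. Proof. by case: theta_highest. Qed.

Lemma highest_ge x : P x -> root_le Pi x theta.
Proof. by case: theta_highest => _; apply. Qed.

Lemma highest_add x : P x -> ~ Delta (theta + x).
Proof.
move=> xP D; have := highest_ge (posD highest_pos xP D).
rewrite /root_le opprD addrA subrr add0r.
by move=> nx; apply: (pos_neq0 xP); apply: (nat_comb_antisym bP) nx; exact: pos_comb.
Qed.

Lemma highest_dominant x : P x -> 0 <= dot x theta.
Proof.
move=> xP; rewrite leNgt; apply/negP => neg.
apply: (highest_add xP); rewrite addrC.
apply: root_add neg _; [exact: pos_root|exact/pos_root/highest_pos|].
exact: pos_sum_neq0 xP highest_pos.
Qed.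

Lemma dot_highest_le x y : root_le Pi x y -> dot x theta <= dot y theta.
Proof.
rewrite /root_le => xy; suff : 0 <= dot (y - x) theta.
  by rewrite linearBl /=; lra.
rewrite dotC dot_simple_sum; apply: sumr_ge0 => i _; apply: mulr_ge0.
  exact: (nat_comb_coord_ge0 bP).
by rewrite dotC; apply: highest_dominant; exact: simple_pos.
Qed.

Lemma highest_sub x : P x -> x <> theta -> 0 < dot x theta -> P (theta - x).
Proof.
move=> xP xne xt; split; last exact: highest_ge.
apply: root_sub; rewrite ?(dotC theta) //; last exact/nesym.
  exact/pos_root/highest_pos.
exact: pos_root.
Qed.

(** Peel simple roots off [p]: by the Jacobi lemma each of them, unless it can
    be added to [q], leaves a smaller [p] with the same property. *)
Lemma root_raise_add q p : P q -> P p -> Delta (q + p) ->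
  exists i, P (q + tnth Pi i).
Proof.
move=> qP pP; have [m] := height_nat bP (pos_comb pP).
elim: m p pP => [|m IH] p pP hm qpD.
  by have := pos_height_ge1 pP; rewrite hm; lra.
have [[i pE]|[i [p' [p'P pE]]]] := pos_decompose pP.
  by exists i; rewrite -pE; exact: posD.
have [|h|h] := pos_jacobi qP (simple_pos i) p'P; first by rewrite -addrA -pE.
  by exists i.
apply: (IH p') => //; last exact: pos_root.
  by move: hm; rewrite pE heightD (height_simple bP) -natr1; lra.
Qed.

(** If no simple root has negative product with [q], then [q] is dominant, so
    [dot q (theta - q) >= 0] and [q] has positive product with [theta]; hence
    [theta - q] is a root that can be added to [q]. *)
Lemma root_raise q : P q -> q <> theta -> exists i, P (q + tnth Pi i).
Proof.
move=> qP qne; apply: contrapT => no.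
have dom i : 0 <= dot q (tnth Pi i).
  rewrite leNgt; apply/negP => neg; apply: no; exists i.
  apply: posD => //; first exact: simple_pos.
  apply: root_add neg _; [exact: pos_root|exact/pos_root/simple_pos|].
  by apply: pos_sum_neq0 => //; exact: simple_pos.
have : 0 <= dot q (theta - q).
  rewrite dot_simple_sum; apply: sumr_ge0 => i _; apply: mulr_ge0 => //.
  exact/(nat_comb_coord_ge0 bP)/highest_ge.
rewrite linearBr /= => h; have qq := dot_gt0 (pos_neq0 qP).
apply: no; apply: (root_raise_add qP (highest_sub qP qne _)); first by lra.
by rewrite addrC subrK; exact/pos_root/highest_pos.
Qed.

Section LongHighest.
Context (theta_long :
  forall gamma, Delta gamma -> dot gamma gamma <= dot theta theta).

(** As [theta] is long, a Cartan integer of [2] or more would make the squared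
    norm of [x - theta] nonpositive. *)
Lemma highest_coroot x : P x -> x <> theta ->
  dot x (coroot dot theta) = 0 \/ dot x (coroot dot theta) = 1.
Proof.
move=> xP xne; have tt := dot_gt0 (pos_neq0 highest_pos).
have [m mE] := rs_integral Delta_rs (pos_root highest_pos) (pos_root xP).
have dE : 2 * dot x theta = m%:~R * dot theta theta.
  by rewrite -mE dot_coroot; field; exact: lt0r_neq0.
have m0 : 0 <= m.
  have := highest_dominant xP => x0.
  by rewrite -(ler0z R); nra.
have m2 : m < 2.
  rewrite ltNge; apply/negP; rewrite -(ler_int R) => m2.
  apply: xne; apply/eqP; rewrite -subr_eq0; apply/eqP/(@dot_eq0 _).
  rewrite linearBl !linearBr /= (dotC theta x).
  by have := theta_long (pos_root xP); nra.
rewrite mE; case: m {mE dE} m0 m2 => [[|[|m]]|m] // _ _; [by left|by right].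
Qed.

(** Orthogonal positive summands of [theta] would make one of them longer. *)
Lemma highest_split x y : P x -> P y -> x + y = theta -> 0 < dot x theta.
Proof.
move=> xP yP xyE; rewrite lt_neqAle highest_dominant // andbT.
apply/eqP => x0; have yE : y = theta - x by rewrite -xyE addrAC subrr add0r.
have := theta_long (pos_root yP); rewrite yE linearBl !linearBr /= (dotC theta x).
by rewrite -x0; have := dot_gt0 (pos_neq0 xP); lra.
Qed.

(** * Affine roots and simple reflections *)

Local Notation hatV := (@hatV R V).
Implicit Types (c d : R) (w : hatV -> hatV) (u z : hatV).

Local Notation affpos := (affine_positive Pi Delta).

(** The element [x + c delta] of the level-zero hyperplane, which is stable
    under the affine Weyl group and contains all affine roots. *)
Definition level0 x c : hatV := (x, c, 0).

Lemma level0D x y c d : level0 x c + level0 y d = level0 (x + y) (c + d).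
Proof. by congr (_, _, _); rewrite addr0. Qed.

Lemma level0N x c : - level0 x c = level0 (- x) (- c).
Proof. by congr (_, _, _); rewrite oppr0. Qed.

Lemma level0_inj x y c d : level0 x c = level0 y d -> x = y /\ c = d.
Proof. by case. Qed.

Lemma emb_level0 x : emb x = level0 x 0. Proof. by []. Qed.

Lemma emb_deltaE x m : emb x + @delta R V *+ m = level0 x m%:R.
Proof.
have -> : @delta R V *+ m = level0 0 m%:R.
  elim: m => [|m IH]; first by rewrite mulr0n.
  by rewrite mulrS IH level0D addr0 -natr1 addrC.
by rewrite emb_level0 level0D addr0 add0r.
Qed.

Lemma delta_subE x m : @delta R V *+ m - emb x = level0 (- x) m%:R.
Proof.
have -> : - emb x = emb (- x) by rewrite emb_level0 level0N oppr0.
by rewrite addrC emb_deltaE.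
Qed.

Lemma delta1_subE x : @delta R V - emb x = level0 (- x) 1.
Proof. exact: (@delta_subE x 1). Qed.

Lemma hat_dotE x y c d : hat_dot dot (level0 x c) (level0 y d) = dot x y.
Proof. by rewrite /hat_dot /= mulr0 mul0r !addr0. Qed.

Lemma hat_reflectionE a c x d :
  hat_reflection dot (level0 a c) (level0 x d) =
  level0 (reflection dot a x) (d - dot x (coroot dot a) * c).
Proof.
rewrite /hat_reflection /hat_coroot !hat_dotE.
have -> : dot x a *: ((2 / dot a a) *: level0 a c) =
    level0 (dot x a *: coroot dot a) (dot x (coroot dot a) * c).
  rewrite dot_coroot; by congr (_, _, _); do 2! rewrite /GRing.scale /=; ring.
by rewrite level0N level0D.
Qed.

Lemma hat_reflectionN u z : hat_reflection dot u (- z) = - hat_reflection dot u z.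
Proof.
suff E : hat_dot dot (- z) u = - hat_dot dot z u.
  by rewrite /hat_reflection E scaleNr opprD.
by rewrite /hat_dot /= linearNl /=; ring.
Qed.

Lemma reflectionK a : a <> 0 -> involutive (reflection dot a).
Proof.
move=> a0 x; have aa := dot_gt0 a0.
rewrite {1}/reflection {2}/reflection -addrA -opprD -scalerDl.
rewrite linearBl linearZl /= (_ : dot x a + _ = 0) ?scale0r ?subr0 //.
by rewrite (dotC (coroot dot a)) dot_coroot; field; exact: lt0r_neq0.
Qed.

Lemma reflectionD a x y :
  reflection dot a (x + y) = reflection dot a x + reflection dot a y.
Proof. by rewrite /reflection linearDl scalerDl opprD addrACA. Qed.

Lemma reflection_isometry a x y : a <> 0 ->
  dot (reflection dot a x) (reflection dot a y) = dot x y.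
Proof.
move=> a0; have aa := dot_gt0 a0; rewrite /reflection /coroot !scalerA.
rewrite linearBl !linearBr !linearZl !linearZr /=.
by rewrite (dotC a y); field; exact: lt0r_neq0.
Qed.

Lemma hat_reflectionK a c x d : a <> 0 ->
  hat_reflection dot (level0 a c) (hat_reflection dot (level0 a c) (level0 x d)) =
  level0 x d.
Proof.
move=> a0; rewrite !hat_reflectionE (reflectionK a0); congr level0.
have aa := dot_gt0 a0; rewrite !dot_coroot /reflection linearBl linearZl /=.
by rewrite (dotC (coroot dot a)) dot_coroot; field; exact: lt0r_neq0.
Qed.

Lemma affine_simple_level0 i :
  exists2 a, Delta a & exists c, affine_simple Pi theta i = level0 a c.
Proof.
case: i => [j|].
  by exists (tnth Pi j); [exact/pos_root/simple_pos|exists 0].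
exists (- theta); first exact/rootN/pos_root/highest_pos.
by exists 1; exact: delta1_subE.
Qed.

Lemma affine_positiveP x (m : int) : Delta x ->
  affpos (level0 x m%:~R) <-> 0 < m \/ (m = 0 /\ P x).
Proof.
move=> xD.
split=> [[[gamma gP]|[gamma [k [gD k1]]]]|].
- rewrite emb_level0 => /level0_inj[<- /esym/eqP]; rewrite intr_eq0 => /eqP ->.
  by right.
- rewrite emb_deltaE => /level0_inj[_ /eqP].
  by rewrite -[k%:R]/(k%:Z%:~R) eqr_int => /eqP ->; left.
case=> [m0|[-> xP]]; last by left; exists x.
right; exists x, `|m|%N; split=> //; first by lia.
rewrite emb_deltaE; congr level0; rewrite -[RHS]/(`|m|%N%:Z%:~R) gtz0_abs //.
Qed.

Lemma affine_positive_level0 z : affpos z ->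
  exists x (m : int), [/\ z = level0 x m%:~R, Delta x & 0 < m \/ (m = 0 /\ P x)].
Proof.
case=> [[x xP <-]|[x [k [xD k1 ->]]]].
  by exists x, 0; split=> //; [exact: pos_root|right].
exists x, k%:Z; split=> //; last by left; lia.
by rewrite emb_deltaE.
Qed.

Lemma affine_pos_neg_false z : affpos z -> affpos (- z) -> False.
Proof.
move=> /affine_positive_level0[x [m [-> xD xm]]].
rewrite level0N -mulrNz affine_positiveP; last exact: rootN.
case: xm => [m0|[m0 xP]]; case=> [|[]]; try lia.
by move=> _; exact: pos_neg_false xP.
Qed.

Local Notation simple_refl i := (hat_reflection dot (affine_simple Pi theta i)).

Lemma simple_reflK i x c : simple_refl i (simple_refl i (level0 x c)) = level0 x c.
Proof.
have [a aD [d ->]] := affine_simple_level0 i.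
by apply: hat_reflectionK; exact: root_neq0.
Qed.

Lemma simple_refl_self i :
  simple_refl i (affine_simple Pi theta i) = - affine_simple Pi theta i.
Proof.
have [a aD [d ->]] := affine_simple_level0 i.
have a0 := root_neq0 aD; have aa := dot_gt0 a0.
rewrite hat_reflectionE reflection_self // level0N; congr level0.
by rewrite dot_coroot; field; exact: lt0r_neq0.
Qed.

Lemma affine_simple_pos i : affpos (affine_simple Pi theta i).
Proof.
case: i => [j|]; first by left; exists (tnth Pi j) => //; exact: simple_pos.
rewrite /= delta1_subE; apply/(@affine_positiveP (- theta) 1); last by left.
exact/rootN/pos_root/highest_pos.
Qed.

Lemma reflectionE a x : reflection dot a x = x - dot x (coroot dot a) *: a.
Proof.
by rewrite /reflection dot_coroot /coroot scalerA; congr (_ - _ *: _); ring.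
Qed.

(** For [delta - theta] the reflection subtracts [dot x (coroot theta)] times
    [theta - delta], and that integer is at most [1] in absolute value unless
    [x] is [theta] or its opposite. *)
Lemma simple_refl_pos i z : affpos z -> z <> affine_simple Pi theta i ->
  affpos (simple_refl i z).
Proof.
move=> /affine_positive_level0[x [m [-> xD xm]]].
case: i => [j|] /=.
  rewrite emb_level0 hat_reflectionE mulr0 subr0 => zne.
  apply/affine_positiveP; first exact: rs_reflection (pos_root (simple_pos j)) xD.
  case: xm => [m0|[m0 xP]]; first by left.
  right; split=> //; apply: simple_reflection_pos => // xE; apply: zne.
  by rewrite xE m0.
have tP := highest_pos; have tt := dot_gt0 (pos_neq0 tP).
rewrite delta1_subE hat_reflectionE.
have cN : dot x (coroot dot (- theta)) = - dot x (coroot dot theta).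
  rewrite !dot_coroot linearNl !linearNr /= opprK.
  by field; exact: lt0r_neq0.
rewrite reflectionE cN scaleNr scalerN !opprK mulr1 opprK.
have ctt : dot theta (coroot dot theta) = 2.
  by rewrite dot_coroot; field; exact: lt0r_neq0.
have [xP zne|nxP] := pos_or_neg xD.
  have m0 : 0 <= m by case: xm => [/ltW|[->]].
  have [xt|xt] := pselect (x = theta).
    rewrite xt ctt scaler_nat mulr2n opprD addrA subrr add0r.
    rewrite -[2]/(2%:~R) -intrD; apply/affine_positiveP; last by left; lia.
    exact/rootN/pos_root.
  case: (highest_coroot xP xt) => cE; rewrite cE.
    by rewrite scale0r subr0 addr0; apply/affine_positiveP.
  rewrite scale1r -[1]/(1%:~R) -intrD; apply/affine_positiveP; last by left; lia.
  rewrite -[theta]scale1r -cE -reflectionE.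
  by apply: rs_reflection => //; exact: pos_root.
have m0 : 1 <= m by case: xm => [|[_ /pos_neg_false]] //; lia.
have [xt|xt] := pselect (- x = theta).
  have xN : x = - theta by rewrite -xt opprK.
  rewrite xN linearNl /= ctt scaleNr opprK scaler_nat mulr2n addrA addNr add0r.
  move=> zne; rewrite -[- 2]/((-2)%:~R) -intrD.
  apply/affine_positiveP; first exact: pos_root.
  case: (eqVneq m 1) => [m1|m1]; first by case: zne; rewrite m1.
  case: (eqVneq m 2) => [->|m2]; first by right.
  by left; lia.
have cE' := linearNl dot (coroot dot theta) x; rewrite /= in cE'.
move=> zne; case: (highest_coroot nxP xt); rewrite cE' => cE.
  have -> : dot x (coroot dot theta) = 0 by lra.
  by rewrite scale0r subr0 addr0; apply/affine_positiveP.
have cE1 : dot x (coroot dot theta) = -1 by lra.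
have xpos : P (x + theta).
  rewrite addrC -[x]opprK; apply: highest_sub => //.
  suff : 2 * dot (- x) theta = dot theta theta by lra.
  move: cE; rewrite -cE' dot_coroot => /(canRL (divfK (lt0r_neq0 tt))) ->.
  by rewrite mul1r.
rewrite cE1 scaleNr scale1r opprK -[- 1]/((-1)%:~R) -intrD.
apply/affine_positiveP; first exact: pos_root.
by case: (eqVneq m 1) => [->|m1]; [right|left; lia].
Qed.

(** * Inversion sets *)

(** An element of the affine Weyl group acts on the level-zero hyperplane by an
    isometry [g] preserving the roots and by a shift [k] along [delta]. *)
Record affine_action w (g : V -> V) (k : V -> R) : Prop := AffineAction {
  act_bij : bijective g;
  act_gD : forall x y, g (x + y) = g x + g y;
  act_isometry : forall x y, dot (g x) (g y) = dot x y;
  act_root : forall x, Delta (g x) <-> Delta x;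
  act_kD : forall x y, k (x + y) = k x + k y;
  act_int : forall x, Delta x -> exists m : int, k x = m%:~R;
  actE : forall x c, w (level0 x c) = level0 (g x) (c + k x) }.

Lemma affine_action_exists w : affine_weyl dot Pi theta w ->
  exists g k, affine_action w g k.
Proof.
elim=> [|i|v w1 _ [g [k A]] _ [h [l B]]|v w1 _ [g [k A]] vK wK].
- exists idfun, (fun=> 0); split=> //.
  + by move=> x y; rewrite addr0.
  + by move=> x _; exists 0.
  + by move=> x c; rewrite addr0.
- have [a aD [c aE]] := affine_simple_level0 i; have a0 := root_neq0 aD.
  exists (reflection dot a), (fun x => - (dot x (coroot dot a) * c)); split.
  + by exists (reflection dot a); exact: reflectionK.
  + exact: reflectionD.
  + by move=> x y; exact: reflection_isometry.
  + move=> x; split; last exact: rs_reflection.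
    by move=> /(rs_reflection Delta_rs aD); rewrite reflectionK.
  + by move=> x y; rewrite linearDl mulrDl opprD.
  + move=> x xD; have [m ->] := rs_integral Delta_rs aD xD.
    have : affpos (level0 a c) by rewrite -aE; exact: affine_simple_pos.
    move=> /affine_positive_level0[y [p [/level0_inj[_ ->] _ _]]].
    by exists (- (m * p)); rewrite mulrNz intrM.
  + by move=> x d; rewrite aE hat_reflectionE.
- exists (g \o h), (fun x => l x + k (h x)); split=> /=.
  + exact: bij_comp (act_bij A) (act_bij B).
  + by move=> x y; rewrite (act_gD B) (act_gD A).
  + by move=> x y; rewrite (act_isometry A) (act_isometry B).
  + by move=> x; rewrite (act_root A) (act_root B).
  + by move=> x y; rewrite (act_kD B) (act_gD B) (act_kD A) addrACA.
  + move=> x xD; have [m ->] := act_int B xD.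
    have /(act_int A)[p ->] : Delta (h x) by apply/(act_root B).
    by exists (m + p); rewrite intrD.
  + by move=> x c; rewrite (actE B) (actE A) addrA.
- have [h gK hK] := act_bij A.
  have hD x y : h (x + y) = h x + h y.
    by apply: (can_inj gK); rewrite (act_gD A) !hK.
  have hR x : Delta (h x) <-> Delta x by rewrite -(act_root A) hK.
  exists h, (fun x => - k (h x)); split=> //.
  + by exists g.
  + by move=> x y; rewrite -(act_isometry A) !hK.
  + by move=> x y; rewrite hD (act_kD A) opprD.
  + move=> x /hR /(act_int A)[m ->]; exists (- m); by rewrite mulrNz.
  + by move=> x c; rewrite -[RHS]vK (actE A) hK subrK.
Qed.

Section Action.
Context (w : hatV -> hatV) (g : V -> V) (k : V -> R) (A : affine_action w g k).

Lemma act_g0 : g 0 = 0.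
Proof. by apply: (addrI (g 0)); rewrite -(act_gD A) !addr0. Qed.

Lemma act_k0 : k 0 = 0.
Proof. by apply: (addrI (k 0)); rewrite -(act_kD A) !addr0. Qed.

Lemma act_gN x : g (- x) = - g x.
Proof. by apply: (addrI (g x)); rewrite -(act_gD A) !subrr act_g0. Qed.

Lemma act_kN x : k (- x) = - k x.
Proof. by apply: (addrI (k x)); rewrite -(act_kD A) !subrr act_k0. Qed.

Lemma act_inj x c y d : w (level0 x c) = w (level0 y d) -> level0 x c = level0 y d.
Proof.
rewrite !(actE A) => /level0_inj[/(bij_inj (act_bij A)) -> /addIr ->].
by [].
Qed.

Lemma actN x c : w (- level0 x c) = - w (level0 x c).
Proof. by rewrite level0N !(actE A) level0N act_gN act_kN opprD. Qed.

Lemma act_surj_root x : Delta x -> exists2 y, Delta y & g y = x.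
Proof.
have [h gK hK] := act_bij A => xD.
by exists (h x); rewrite ?hK // -(act_root A) hK.
Qed.

(** A simple reflection permutes the positive affine roots other than the
    simple root itself, so composing with it only affects [z0]. *)
Lemma inversions_remove i z0 : affpos z0 -> w z0 = - affine_simple Pi theta i ->
  inversions Pi Delta (simple_refl i \o w) = inversions Pi Delta w `\ z0.
Proof.
move=> z0P wz0; have [x0 [m0 [z0E _ _]]] := affine_positive_level0 z0P.
have kP := affine_simple_pos i.
apply/seteqP; split=> z.
  case=> zP /=; have [x [m [zE _ _]]] := affine_positive_level0 zP.
  rewrite -hat_reflectionN => sP.
  have wzP : affpos (- w z).
    have -> : - w z = simple_refl i (simple_refl i (- w z)).
      by rewrite zE (actE A) level0N simple_reflK.
    apply: simple_refl_pos => // sE.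
    have wzE : w z = w (- z0).
      rewrite z0E actN -z0E wz0 opprK.
      have := simple_refl_self i; rewrite -[X in hat_reflection dot _ X]sE.
      rewrite zE (actE A) level0N simple_reflK.
      by rewrite -level0N => /oppr_inj.
    apply: (affine_pos_neg_false z0P).
    suff -> : - z0 = z by [].
    by move: wzE; rewrite zE z0E level0N => /act_inj.
  split=> // zz0; apply: (affine_pos_neg_false kP).
  by move: sP; rewrite zz0 wz0 opprK simple_refl_self.
case=> -[zP nP] zz0; have [x [m [zE _ _]]] := affine_positive_level0 zP.
split=> //=; rewrite -hat_reflectionN; apply: simple_refl_pos => //.
move=> wzE; apply: zz0.
have : w z = w z0 by rewrite wz0 -wzE opprK.
by rewrite zE z0E => /act_inj.
Qed.
End Action.

(** * Minuscule elements *)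

Section Minuscule.
Context (w : hatV -> hatV) (g : V -> V) (k : V -> R) (A : affine_action w g k).
Context (I : set V).
Context (I_inversions : inversions Pi Delta w = [set delta - emb gamma | gamma in I]).

Lemma inversion_deltaB x : inversions Pi Delta w (level0 (- x) 1) <-> I x.
Proof.
rewrite I_inversions; split=> [[y Iy]|Ix]; last by exists x; rewrite ?delta1_subE.
by rewrite delta1_subE => /level0_inj[/oppr_inj <-].
Qed.

Lemma inversion_level x c : inversions Pi Delta w (level0 x c) -> c = 1.
Proof.
by rewrite I_inversions => -[y _]; rewrite delta1_subE => /level0_inj[_ <-].
Qed.

(** Since [x] and [2 delta - x] are not inversions of [w], the shift [k x] is
    [0], [1] or [2]; the sign of [g x] and the membership of [x] in [I], i.e.
    the sign of [w (delta - x)], then determine each other from [k x]. *)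
Lemma minuscule_shift x : P x -> exists m : int,
  [/\ k x = m%:~R, P (g x) -> (m = 0 /\ ~ I x) \/ (m = 1 /\ I x) &
      P (- g x) -> (m = 1 /\ ~ I x) \/ (m = 2 /\ I x)].
Proof.
move=> xP; have xD := pos_root xP; have [m mE] := act_int A xD.
have gxD : Delta (g x) by apply/(act_root A).
have wN c : w (level0 (- x) c) = level0 (- g x) (c - m%:~R).
  by rewrite (actE A) (act_gN A) (act_kN A) mE.
have low : ~ (0 < - m \/ (- m = 0 /\ P (- g x))).
  rewrite -affine_positiveP; last exact: rootN.
  move=> neg; suff /inversion_level/eqP : inversions Pi Delta w (level0 x 0).
    by rewrite eq_sym oner_eq0.
  split; first by apply/(@affine_positiveP x 0) => //; right.
  by rewrite (actE A) mE level0N add0r -mulrNz.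
have high : ~ (0 < m - 2 \/ (m - 2 = 0 /\ P (g x))).
  rewrite -affine_positiveP // => neg.
  suff /inversion_level/eqP : inversions Pi Delta w (level0 (- x) 2).
    by rewrite (eqr_nat R 2 1).
  split; first by apply/(@affine_positiveP (- x) 2); [exact: rootN|left].
  by rewrite wN level0N !opprK opprB -[2]/(2%:~R) -intrB.
have inI : I x <-> 0 < m - 1 \/ (m - 1 = 0 /\ P (g x)).
  rewrite -inversion_deltaB -affine_positiveP //.
  have -> : level0 (g x) (m - 1)%:~R = - w (level0 (- x) 1).
    by rewrite wN level0N opprK opprB intrB.
  split=> [[]//|neg]; split=> //.
  by apply/(@affine_positiveP (- x) 1); [exact: rootN|left].
exists m; split=> // gP.
  have m2 : m < 2.
    rewrite ltNge; apply/negP => m2; apply: high.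
    by have [->|m3] := eqVneq m 2; [right|left; lia].
  have m0 : 0 <= m by rewrite leNgt; apply/negP => m0; apply: low; left; lia.
  have [m1|m1] := eqVneq m 1; [right|left]; split=> //; first 1 last.
  - by lia.
  - by move/inI; case=> [|[]]; lia.
  - by apply/inI; right; split=> //; lia.
have m2 : m <= 2 by rewrite leNgt; apply/negP => m2; apply: high; left; lia.
have m0 : 0 < m.
  rewrite ltNge; apply/negP => m0; apply: low.
  by have [->|m1] := eqVneq m 0; [right|left; lia].
have nP : ~ P (g x) by move=> /pos_neg_false /(_ gP).
have [m1|m1] := eqVneq m 1; [left|right]; split=> //.
- by move/inI; case=> [|[_ //]]; lia.
- by lia.
- by apply/inI; left; lia.
Qed.

Lemma shift_gpos x : P x -> P (g x) -> (k x = 0 /\ ~ I x) \/ (k x = 1 /\ I x).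
Proof.
move=> xP gP; have [m [-> pos _]] := minuscule_shift xP.
by case: (pos gP) => -[-> ?]; [left|right].
Qed.

Lemma shift_gneg x : P x -> P (- g x) -> (k x = 1 /\ ~ I x) \/ (k x = 2 /\ I x).
Proof.
move=> xP gP; have [m [-> _ neg]] := minuscule_shift xP.
by case: (neg gP) => -[-> ?]; [left|right].
Qed.

Lemma minuscule_cases x : P x ->
  [\/ [/\ k x = 0, P (g x) & ~ I x], [/\ k x = 1, P (g x) & I x],
      [/\ k x = 1, P (- g x) & ~ I x] | [/\ k x = 2, P (- g x) & I x]].
Proof.
move=> xP; have gxD : Delta (g x) by apply/(act_root A)/pos_root.
case: (pos_or_neg gxD) => gP.
  by case: (shift_gpos xP gP) => -[? ?]; [constructor 1|constructor 2].
by case: (shift_gneg xP gP) => -[? ?]; [constructor 3|constructor 4].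
Qed.

(** Preimages under [g] of two roots come with signs of their own; this is how
    a decomposition of [g nu] is pulled back to one of [nu]. *)
Lemma pullback_sum x p q : g x = p + q -> Delta p -> Delta q ->
  exists x1 x2, [/\ Delta x1, Delta x2, g x1 = p, g x2 = q & x = x1 + x2].
Proof.
move=> xE /(act_surj_root A)[x1 x1D x1E] /(act_surj_root A)[x2 x2D x2E].
exists x1, x2; split=> //; apply: (bij_inj (act_bij A)).
by rewrite (act_gD A) x1E x2E.
Qed.

(** If the positive affine root [- w (delta - nu)] were a sum of two positive
    ones, pulling these back would write [nu] as a sum one of whose terms is a
    smaller element of [I]. *)
Lemma min_elt_simple nu : I `<=` P -> min_elts Pi I nu ->
  exists i, w (level0 (- nu) 1) = - affine_simple Pi theta i.
Proof.
move=> IP [Inu nu_min]; have nuP := IP _ Inu.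
have nu_split x1 x2 : P x1 -> P x2 -> nu = x1 + x2 -> ~ I x1 /\ ~ I x2.
  move=> x1P x2P nuE; split=> /nu_min; rewrite nuE.
    by move=> /(_ (root_le_addr _ x2P))/esym/(add_pos_neq x2P).
  by move=> /(_ (root_le_addl _ x1P))/esym; rewrite addrC => /(add_pos_neq x1P).
have nn x1 x2 : P (- x1) -> P (- x2) -> nu <> x1 + x2.
  move=> x1P x2P nuE; apply: (pos_sum_neq0 nuP (posD x1P x2P _)).
    by rewrite -opprD -nuE; exact/rootN/pos_root.
  by rewrite -opprD -nuE subrr.
have wE : w (level0 (- nu) 1) = level0 (- g nu) (1 - k nu).
  by rewrite (actE A) (act_gN A) (act_kN A).
have [[//]|[k1 gP _]|[//]|[k2 gN _]] := minuscule_cases nuP.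
  have [[i pE]|[i [q [qP pE]]]] := pos_decompose gP.
    by exists (Some i); rewrite wE k1 subrr pE -[X in level0 _ X]oppr0 -level0N.
  exfalso.
  have [x1 [x2 [x1D x2D x1E x2E nuE]]] :=
    pullback_sum pE (pos_root (simple_pos i)) (pos_root qP).
  have kE : k x1 + k x2 = 1 by rewrite -(act_kD A) -nuE.
  have g1 : P (g x1) by rewrite x1E; exact: simple_pos.
  have g2 : P (g x2) by rewrite x2E.
  have key x y : P (g x) -> P (g y) -> P x -> P (- y) -> k x + k y = 1 -> False.
    move=> gx gy xP yP; have := shift_gneg yP; rewrite (act_gN A) opprK (act_kN A).
    move=> /(_ gy) ky; have := shift_gpos xP gx.
    by case: ky => -[ky _]; case=> -[kx _]; move: kx ky; lra.
  case: (pos_or_neg x1D) (pos_or_neg x2D) => x1P [] x2P.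
  - have [nI1 nI2] := nu_split _ _ x1P x2P nuE.
    case: (shift_gpos x1P g1) => -[h1 //]; case: (shift_gpos x2P g2) => -[h2 //] _ _.
    by move: h1 h2 kE; lra.
  - exact: (key x1 x2).
  - by apply: (key x2 x1) => //; rewrite addrC.
  - exact: nn nuE.
have [qt|qt] := pselect (- g nu = theta).
  exists None; rewrite wE k2 qt /= delta1_subE level0N opprK; congr level0.
  by lra.
exfalso; have [i qP] := root_raise gN qt.
have pE : g nu = tnth Pi i + - (- g nu + tnth Pi i).
  by rewrite opprD opprK addrCA subrr addr0.
have [x1 [x2 [x1D x2D x1E x2E nuE]]] :=
  pullback_sum pE (pos_root (simple_pos i)) (rootN (pos_root qP)).
have kE : k x1 + k x2 = 2 by rewrite -(act_kD A) -nuE.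
have g1 : P (g x1) by rewrite x1E; exact: simple_pos.
have g2 : P (- g x2) by rewrite x2E opprK.
case: (pos_or_neg x1D) (pos_or_neg x2D) => x1P [] x2P.
- have [nI1 nI2] := nu_split _ _ x1P x2P nuE.
  case: (shift_gpos x1P g1) => -[h1 //]; case: (shift_gneg x2P g2) => -[h2 //] _ _.
  by move: h1 h2 kE; lra.
- have := shift_gpos x2P; rewrite (act_gN A) (act_kN A) => /(_ g2) h2.
  have h1 := shift_gpos x1P g1; move: kE.
  by case: h1 => -[h1 _]; case: h2 => -[h2 _]; move: h1 h2; lra.
- have := shift_gneg x1P; rewrite (act_gN A) opprK (act_kN A) => /(_ g1) h1.
  have h2 := shift_gneg x2P g2; move: kE.
  by case: h1 => -[h1 _]; case: h2 => -[h2 _]; move: h1 h2; lra.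
- exact: nn nuE.
Qed.

(** If the positive affine root [w (delta - eta)] were a sum of two positive
    ones, pulling these back would yield an element of [I] whose sum with [eta]
    is a larger root. *)
Lemma max_elt_simple eta : abelian_ideal Pi Delta I ->
  max_elts Pi (P `\` I) eta -> (forall gamma, I gamma -> ~ Delta (eta + gamma)) ->
  exists i, w (level0 (- eta) 1) = affine_simple Pi theta i.
Proof.
move=> [IP Iup Iab] [[etaP nIeta] eta_max] eta_ab.
have up x y : P x -> P y -> x = eta + y -> I x.
  move=> xP yP xE; apply: contrapT => nIx.
  have := eta_max x (conj xP nIx); rewrite xE => /(_ (root_le_addr _ yP)).
  exact: add_pos_neq.
have nn x1 x2 : P (- x1) -> P (- x2) -> eta <> x1 + x2.
  move=> x1P x2P nuE; apply: (pos_sum_neq0 etaP (posD x1P x2P _)).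
    by rewrite -opprD -nuE; exact/rootN/pos_root.
  by rewrite -opprD -nuE subrr.
have wE : w (level0 (- eta) 1) = level0 (- g eta) (1 - k eta).
  by rewrite (actE A) (act_gN A) (act_kN A).
have [[k0 gP _]|[//]|[k1 gN _]|[//]] := minuscule_cases etaP.
  have [qt|qt] := pselect (g eta = theta).
    by exists None; rewrite wE k0 qt subr0 /= delta1_subE.
  exfalso; have [i qP] := root_raise gP qt.
  have pE : g eta = (g eta + tnth Pi i) + - tnth Pi i by rewrite addrK.
  have [x1 [x2 [x1D x2D x1E x2E etaE]]] :=
    pullback_sum pE (pos_root qP) (rootN (pos_root (simple_pos i))).
  have kE : k x1 + k x2 = 0 by rewrite -(act_kD A) -etaE.
  have g1 : P (g x1) by rewrite x1E.
  have g2 : P (- g x2) by rewrite x2E opprK; exact: simple_pos.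
  case: (pos_or_neg x1D) (pos_or_neg x2D) => x1P [] x2P.
  - have h1 := shift_gpos x1P g1; have h2 := shift_gneg x2P g2; move: kE.
    by case: h1 => -[h1 _]; case: h2 => -[h2 _]; move: h1 h2; lra.
  - have x1E' : x1 = eta + - x2 by rewrite etaE addrK.
    have Ix1 := up _ _ x1P x2P x1E'.
    have := shift_gpos x2P; rewrite (act_gN A) (act_kN A) => /(_ g2).
    case: (shift_gpos x1P g1) => -[h1 // _].
    case=> -[h2 I2]; first by move: h1 h2 kE; lra.
    by apply: (eta_ab _ I2); rewrite -x1E'.
  - have x2E' : x2 = eta + - x1 by rewrite etaE addrAC subrr add0r.
    have Ix2 := up _ _ x2P x1P x2E'.
    have := shift_gneg x1P; rewrite (act_gN A) opprK (act_kN A) => /(_ g1).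
    case: (shift_gneg x2P g2) => -[h2 // _].
    case=> -[h1 I1]; first by move: h1 h2 kE; lra.
    by apply: (eta_ab _ I1); rewrite -x2E'.
  - exact: nn etaE.
have [[i pE]|[i [q [qP pE]]]] := pos_decompose gN.
  by exists (Some i); rewrite wE k1 subrr pE.
exfalso; have pE' : g eta = - tnth Pi i + - q by rewrite -opprD -pE opprK.
have [x1 [x2 [x1D x2D x1E x2E etaE]]] :=
  pullback_sum pE' (rootN (pos_root (simple_pos i))) (rootN (pos_root qP)).
have kE : k x1 + k x2 = 1 by rewrite -(act_kD A) -etaE.
have g1 : P (- g x1) by rewrite x1E opprK; exact: simple_pos.
have g2 : P (- g x2) by rewrite x2E opprK.
have key x y : P (- g x) -> P (- g y) -> P x -> P (- y) -> eta = x + y ->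
    k x + k y = 1 -> False.
  move=> gx gy xP yP xyE kxy.
  have xE : x = eta + - y by rewrite xyE addrK.
  have Ix := up _ _ xP yP xE.
  have := shift_gpos yP; rewrite (act_gN A) (act_kN A) => /(_ gy).
  case: (shift_gneg xP gx) => -[kx // _].
  case=> -[ky Iy]; first by move: kx ky kxy; lra.
  by apply: (eta_ab _ Iy); rewrite -xE; exact: pos_root.
case: (pos_or_neg x1D) (pos_or_neg x2D) => x1P [] x2P.
- have h1 := shift_gneg x1P g1; have h2 := shift_gneg x2P g2; move: kE.
  by case: h1 => -[h1 _]; case: h2 => -[h2 _]; move: h1 h2; lra.
- exact: (key x1 x2).
- by apply: (key x2 x1) => //; rewrite addrC.
- by apply: (nn x1 x2).
Qed.

(** The two roots are carried by [g] to roots with sum [- alpha], which then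
    have opposite signs since [alpha] is indecomposable. *)
Lemma complementary_pair j x y : g theta = - tnth Pi j -> k theta = 2 ->
  P x -> P y -> x + y = theta -> I x <-> ~ I y.
Proof.
move=> gt kt xP yP xyE.
have gE : - g x + - g y = tnth Pi j by rewrite -opprD -(act_gD A) xyE gt opprK.
have kE : k x + k y = 2 by rewrite -(act_kD A) xyE.
have bothpos : P (g x) -> P (g y) -> False.
  move=> gx gy; apply: (pos_neg_false (simple_pos j)).
  rewrite -gE opprD !opprK; apply: posD => //.
  by rewrite -(act_gD A) xyE gt; exact/rootN/pos_root/simple_pos.
have [] := minuscule_cases xP => -[kx gx Ix];
  have [] := minuscule_cases yP => -[ky gy Iy];
  try (by case: (bothpos gx gy)); try (by case: (simple_indecomposable gx gy gE));
  try (by split); by move: kx ky kE; lra.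
Qed.

End Minuscule.

(** * Changing an ideal without changing its simple rootlet *)

(** Deleting [z0] from the inversions of the composite leads back to [w]. *)
Lemma inversions_add w i z0 : affine_weyl dot Pi theta w -> affpos z0 ->
  w z0 = affine_simple Pi theta i ->
  inversions Pi Delta (simple_refl i \o w) = inversions Pi Delta w `|` [set z0].
Proof.
move=> W z0P wz0; have W' := affine_weyl_comp (affine_weyl_gen _ _ _ i) W.
have [g [k A]] := affine_action_exists W.
have [g' [k' A']] := affine_action_exists W'.
have wz0' : (simple_refl i \o w) z0 = - affine_simple Pi theta i.
  by rewrite /= wz0 simple_refl_self.
have := inversions_remove A' z0P wz0'.
have -> : inversions Pi Delta (simple_refl i \o (simple_refl i \o w)) =
    inversions Pi Delta w.
  have E z : affpos z -> (simple_refl i \o (simple_refl i \o w)) z = w z.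
    move=> /affine_positive_level0[x [m [-> _ _]]].
    by rewrite /= (actE A) simple_reflK.
  by apply/seteqP; split=> z [zP] ?; split=> //; rewrite ?E // -E.
move=> ->; rewrite setUC setDUK // => z ->; split=> //.
by rewrite wz0' opprK; exact: affine_simple_pos.
Qed.

Section SimpleRootlet.
Context (j : 'I_n).
Local Notation alpha := (tnth Pi j).
Local Notation Ab_alpha := (Ab dot Pi Delta theta alpha).
Implicit Types I J : set V.

Lemma Ab_action I : Ab_alpha I -> exists w g k,
  [/\ affine_action w g k, minuscule_for dot Pi Delta theta I w,
      w (level0 (- theta) 2) = emb alpha, g theta = - alpha & k theta = 2].
Proof.
case=> _ _ [w wI]; rewrite delta_subE => wE; have [W _ _] := wI.
have [g [k A]] := affine_action_exists W.
exists w, g, k; split=> //; move: wE; rewrite (actE A) emb_level0 => /level0_inj[].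
  by rewrite (act_gN A) => <-; rewrite opprK.
by rewrite (act_kN A) => _ /eqP; rewrite subr_eq0 => /eqP.
Qed.

Lemma Ab_ideal I : Ab_alpha I -> abelian_ideal Pi Delta I.
Proof. by case. Qed.

Lemma Ab_pos I : Ab_alpha I -> I `<=` P.
Proof. by case=> -[]. Qed.

Lemma Ab_theta I : Ab_alpha I -> I theta.
Proof.
move=> [[IP Iup _] [x Ix] _]; apply: (Iup x) => //; first exact: highest_pos.
exact/highest_ge/IP.
Qed.

Lemma Ab_pair I x y : Ab_alpha I -> P x -> P y -> x + y = theta -> I x <-> ~ I y.
Proof.
move=> /Ab_action[w [g [k [A [_ _ Ii] _ gt kt]]]] xP yP xyE.
exact: (complementary_pair A Ii gt kt xP yP xyE).
Qed.

Lemma simple_refl_fix i a c : affine_simple Pi theta i = level0 a c ->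
  dot alpha a = 0 -> simple_refl i (emb alpha) = emb alpha.
Proof.
move=> -> a0; rewrite emb_level0 hat_reflectionE reflectionE dot_coroot a0.
by rewrite mulr0 mul0r mul0r scale0r !subr0.
Qed.

(** The reflection that deletes [nu] fixes the rootlet because
    [2 delta - theta] is orthogonal to [delta - nu]. *)
Lemma Ab_remove I nu : Ab_alpha I -> min_elts Pi I nu -> dot nu theta = 0 ->
  Ab_alpha (I `\ nu).
Proof.
move=> IA nu_min nut; have nuI := nu_min.1; have nuP := Ab_pos IA nuI.
have [w [g [k [A [W Ir Ii] wt gt kt]]]] := Ab_action IA.
have [i wnu] := min_elt_simple A Ii (Ab_pos IA) nu_min.
have [IP Iup Iab] := Ab_ideal IA.
split.
- split=> [x [/IP]//|x y [Ix xnu] yP xy|x y [Ix _] [Iy _]]; last exact: Iab.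
  split; first exact: Iup xy.
  by move=> ynu; apply: xnu; apply: nu_min.2; rewrite // -ynu.
- exists theta; split; first exact: Ab_theta.
  move=> tnu; have := dot_gt0 (pos_neq0 highest_pos).
  by rewrite {1}tnu nut ltxx.
- exists (simple_refl i \o w); last first.
    rewrite delta_subE /= wt.
    have iE : affine_simple Pi theta i = level0 (g nu) (k nu - 1).
      rewrite -[LHS]opprK -wnu (actE A) (act_gN A) (act_kN A) level0N !opprK.
      by rewrite opprB.
    apply: (simple_refl_fix iE).
    by rewrite -[alpha]opprK -gt linearNl /= (act_isometry A) dotC nut oppr0.
  split; [exact: affine_weyl_comp (affine_weyl_gen _ _ _ i) W|by move=> x [/Ir]|].
  rewrite (inversions_remove A _ wnu); last first.
    by apply/(@affine_positiveP (- nu) 1); [exact/rootN/pos_root|left].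
  rewrite Ii; apply/seteqP; split=> z.
    move=> [[x Ix <-] xnu]; exists x => //; split=> // xE; apply: xnu.
    by rewrite xE /= delta1_subE.
  move=> [x [Ix xnu] <-]; split; first by exists x.
  by rewrite /= delta1_subE => /level0_inj[/oppr_inj /xnu].
Qed.

Lemma Ab_add I eta : Ab_alpha I -> max_elts Pi (P `\` I) eta ->
  (forall gamma, I gamma -> ~ Delta (eta + gamma)) -> dot eta theta = 0 ->
  Ab_alpha (I `|` [set eta]).
Proof.
move=> IA eta_max eta_ab etat; have [etaP nIeta] := eta_max.1.
have [w [g [k [A [W Ir Ii] wt gt kt]]]] := Ab_action IA.
have [i weta] := max_elt_simple A Ii (Ab_ideal IA) eta_max eta_ab.
have [IP Iup Iab] := Ab_ideal IA.
split.
- split=> [x [/IP|->]//|x y [Ix|->] yP xy|x y].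
  + by left; exact: Iup xy.
  + have [Iy|nIy] := pselect (I y); first by left.
    by right; exact: eta_max.2.
  + case=> [Ix|->] [Iy|->]; [exact: Iab| |exact: eta_ab|].
      by rewrite addrC; exact: eta_ab.
    exact/double_not_root/pos_root.
- by exists theta; left; exact: Ab_theta.
- exists (simple_refl i \o w); last first.
    rewrite delta_subE /= wt.
    have iE : affine_simple Pi theta i = level0 (- g eta) (1 - k eta).
      by rewrite -weta (actE A) (act_gN A) (act_kN A).
    apply: (simple_refl_fix iE).
    rewrite -[alpha]opprK -gt linearNl linearNr /= (act_isometry A) dotC etat.
    by rewrite !oppr0.
  split; [exact: affine_weyl_comp (affine_weyl_gen _ _ _ i) W| |].
    by move=> x [/Ir//|->]; exact: pos_root.
  rewrite (inversions_add W _ weta); last first.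
    by apply/(@affine_positiveP (- eta) 1); [exact/rootN/pos_root|left].
  rewrite Ii; apply/seteqP; split=> z.
    move=> [[x Ix <-]|->]; first by exists x => //; left.
    by exists eta; [right|rewrite delta1_subE].
  move=> [x [Ix|->] <-]; first by left; exists x.
  by right; rewrite /= delta1_subE.
Qed.

(** Below an element of [I] orthogonal to [theta] there is a minimal element of
    [I], again orthogonal to [theta] since [theta] is dominant, and [Ab_remove]
    would delete it. *)
Lemma minimal_dot_gt0 I x : minimal_in Ab_alpha I -> I x -> 0 < dot x theta.
Proof.
move=> [IA I_min] Ix; rewrite lt_neqAle highest_dominant ?andbT; last exact: Ab_pos Ix.
apply/negP => /eqP x0.
have [nu nu_min nu0] : exists2 nu, min_elts Pi I nu & dot nu theta = 0.
  have [m] := height_nat base_basis (pos_comb (Ab_pos IA Ix)).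
  elim/ltn_ind: m x Ix x0 => m IH x Ix x0 xm.
  have [?|nmin] := pselect (min_elts Pi I x); first by exists x.
  have [y [Iy yx ynx]] : exists y, [/\ I y, root_le Pi y x & y <> x].
    apply: contrapT => no; apply: nmin; split=> // y Iy yx.
    by apply: contrapT => ynx; apply: no; exists y.
  have [p pm] := height_nat base_basis (pos_comb (Ab_pos IA Iy)).
  apply: (IH p _ y Iy _ pm).
    have : x - y <> 0 by move/eqP; rewrite subr_eq0 => /eqP/nesym.
    move=> /(height_ge1 base_basis yx); rewrite heightD heightN xm pm.
    by rewrite -(ltr_nat R); lra.
  apply/eqP; rewrite eq_le highest_dominant ?andTb; last exact: Ab_pos Iy.
  by rewrite [X in _ <= X]x0; exact: dot_highest_le.
have := I_min _ (Ab_remove IA nu_min nu0) (@subDsetl _ _ _) => E.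
by have := nu_min.1; rewrite -E => -[_]; apply.
Qed.

(** As long as [eta + gamma] differs from [theta], a simple root can be added to
    it, and by the Jacobi lemma it can already be added to [gamma]: it cannot be
    added to [eta], which would then produce two elements of [I] with sum a
    root.  Thus [gamma] can be raised inside [I] until the sum is [theta]. *)
Lemma max_elt_complement I eta gamma : abelian_ideal Pi Delta I ->
  max_elts Pi (P `\` I) eta -> I gamma -> Delta (eta + gamma) -> I (theta - eta).
Proof.
move=> [IP Iup Iab] [[etaP nIeta] eta_max].
have up b : P b -> P (eta + b) -> I (eta + b).
  move=> bP ebP; apply: contrapT => nI.
  by have := eta_max _ (conj ebP nI) (root_le_addr _ bP) => /(add_pos_neq bP).
have leP x : P x -> nat_comb Pi (theta - x) by exact: highest_ge.
move=> Ig egD; have egP := posD etaP (IP _ Ig) egD.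
have [m] := height_nat base_basis (leP _ egP).
elim: m gamma Ig egD egP => [|m IH] gamma Ig egD egP hm;
  have [<-|egt] := pselect (eta + gamma = theta);
  try by rewrite addrAC subrr add0r.
  have nz : theta - (eta + gamma) <> 0.
    by move/eqP; rewrite subr_eq0 => /eqP/nesym.
  by have := height_ge1 base_basis (leP _ egP) nz; rewrite hm; lra.
have [i egiP] := root_raise egP egt.
have bP := simple_pos i.
have D : tnth Pi i + eta + gamma = eta + gamma + tnth Pi i by rewrite -addrA addrC.
have [|beP|bgP] := pos_jacobi bP etaP (IP _ Ig); first by rewrite D; exact: pos_root.
  exfalso; rewrite addrC in beP.
  apply: (Iab _ _ (up _ bP beP) Ig).
  by rewrite [eta + _]addrC D; exact: pos_root.
have egE : eta + (tnth Pi i + gamma) = eta + gamma + tnth Pi i.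
  by rewrite [tnth Pi i + _]addrC addrA.
apply: (IH (tnth Pi i + gamma)).
- by apply: (Iup gamma) => //; exact: root_le_addl.
- by rewrite egE; exact: pos_root.
- by rewrite egE.
- by move: hm; rewrite egE !(heightD, heightN) (height_simple base_basis) -natr1; lra.
Qed.

(** If [theta - eta] were not in the maximal ideal, the preceding lemma would
    exclude every root [eta + gamma], and [eta] would be orthogonal to [theta]
    because of the pair [eta, theta - eta]; so [eta] could be added. *)
Lemma maximal_complement I eta : maximal_in Ab_alpha I ->
  max_elts Pi (P `\` I) eta -> I (theta - eta).
Proof.
move=> [IA I_max] eta_max; have [etaP nIeta] := eta_max.1.
apply: contrapT => nI.
have eta_ab gamma : I gamma -> ~ Delta (eta + gamma).
  by move=> Ig D; apply: nI; exact: max_elt_complement (Ab_ideal IA) eta_max Ig D.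
have eta0 : dot eta theta = 0.
  apply/eqP; rewrite eq_le highest_dominant // andbT leNgt; apply/negP => pos.
  have etat : eta <> theta by move=> E; apply: nIeta; rewrite E; exact: Ab_theta.
  have cP := highest_sub etaP etat pos.
  by apply/nIeta/(Ab_pair IA etaP cP) => //; rewrite addrC subrK.
have := I_max _ (Ab_add IA eta_max eta_ab eta0) (@subsetUl _ _ _) => E.
by apply: nIeta; rewrite -E; right.
Qed.

(** There are finitely many positive roots, so smaller and smaller ideals
    cannot go on for ever. *)
Lemma minimal_below I : Ab_alpha I -> exists2 J, minimal_in Ab_alpha J & J `<=` I.
Proof.
have /finite_seqP[s sE] := rs_finite Delta_rs.
pose card J := count (fun x => `[< J x >]) s.
have card_lt J1 J2 : Ab_alpha J2 -> J1 `<=` J2 -> J1 <> J2 -> (card J1 < card J2)%N.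
  move=> J2A J12 Jne.
  have [x [J2x nJ1x]] : exists x, J2 x /\ ~ J1 x.
    apply: contrapT => no; apply: Jne; apply/seteqP; split=> // x J2x.
    by apply: contrapT => nJ1x; apply: no; exists x.
  have xs : x \in s by have := pos_root (Ab_pos J2A J2x); rewrite sE.
  have /permP cE := perm_to_rem xs.
  rewrite /card !cE /= asboolF // asboolT // ltnS add0n.
  by apply: sub_count => y /asboolP J1y; apply/asboolP; exact: J12.
have [m mE] : exists m, card I = m by exists (card I).
elim/ltn_ind: m I mE => m IH I mE IA.
have [?|nmin] := pselect (minimal_in Ab_alpha I); first by exists I.
have [J [JA JI JnI]] : exists J, [/\ Ab_alpha J, J `<=` I & J <> I].
  apply: contrapT => no; apply: nmin; split=> // J JA JI.
  by apply: contrapT => JnI; apply: no; exists J.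
have JIlt : (card J < m)%N by rewrite -mE; exact: card_lt.
have [K Kmin KJ] := IH _ JIlt J erefl JA.
by exists K => //; exact: subset_trans JI.
Qed.

(** * The smallest and the largest ideal with a given simple rootlet *)

Section Extremal.
Context (Imin Imax : set V).
Context (Imin_min : minimal_in Ab_alpha Imin) (Imax_max : maximal_in Ab_alpha Imax).
Context (Imin_sub : Imin `<=` Imax).

Local Notation IminA := (proj1 Imin_min).
Local Notation ImaxA := (proj1 Imax_max).

(** Both ideals contain exactly one root of each pair with sum [theta], and one
    ideal contains the other. *)
Lemma dot_gt0_Imin x : Imax x -> 0 < dot x theta -> Imin x.
Proof.
move=> Ix x0; have xP := Ab_pos ImaxA Ix.
have [->|xt] := pselect (x = theta); first exact: Ab_theta IminA.
have yP := highest_sub xP xt x0.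
apply: contrapT => nIx.
have /contrapT Iy : ~ ~ Imin (theta - x).
  by move=> nIy; apply: nIx; apply/(Ab_pair IminA xP yP (subrKC _ _)).
have /(Ab_pair ImaxA xP yP (subrKC _ _)) := Ix; apply; exact: Imin_sub.
Qed.

(** A smaller element [nu] of [Imin] would give [theta - nu] above [eta] and
    outside [Imax]. *)
Lemma max_to_min eta : max_elts Pi (P `\` Imax) eta ->
  min_elts Pi Imin (theta - eta) /\ 0 < dot eta theta.
Proof.
move=> eta_max; have [[etaP nIeta] etaU] := eta_max.
have Inu := maximal_complement Imax_max eta_max.
have nuP := Ab_pos ImaxA Inu.
split; last exact: (highest_split etaP nuP (subrKC _ _)).
split; first by apply: dot_gt0_Imin => //; apply: (highest_split nuP etaP); rewrite subrK.
move=> nu Imu le; have mP := Ab_pos IminA Imu.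
have [mt|mt] := pselect (nu = theta).
  by rewrite mt in le *; exact: (root_le_antisym base_basis le (highest_ge nuP)).
have cP := highest_sub mP mt (minimal_dot_gt0 Imin_min Imu).
have nIc : ~ Imax (theta - nu).
  by apply/(Ab_pair ImaxA mP cP (subrKC _ _)); exact: Imin_sub.
have leC : root_le Pi eta (theta - nu).
  by move: le; rewrite /root_le addrAC.
by rewrite -(etaU _ (conj cP nIc) leC) opprB subrKC.
Qed.

(** A root above [theta - nu] and outside [Imax] is again in H, so it comes from
    an element of [Imin] below [nu]. *)
Lemma min_to_max nu : min_elts Pi Imin nu -> nu <> theta ->
  max_elts Pi (P `\` Imax) (theta - nu).
Proof.
move=> [Inu nuL] nut; have nuP := Ab_pos IminA Inu.
have nu0 := minimal_dot_gt0 Imin_min Inu.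
have etaP := highest_sub nuP nut nu0.
split.
  by split=> //; apply/(Ab_pair ImaxA nuP etaP (subrKC _ _)); exact: Imin_sub.
move=> eta [eP nIe] le.
have e0 : 0 < dot eta theta.
  apply: lt_le_trans (dot_highest_le le).
  by apply: (highest_split etaP nuP); rewrite subrK.
have et : eta <> theta by move=> E; apply: nIe; rewrite E; exact: Ab_theta ImaxA.
have cP := highest_sub eP et e0.
have cE : theta - eta + eta = theta by rewrite subrK.
have Ic : Imax (theta - eta) by apply/(Ab_pair ImaxA cP eP cE).
have leC : root_le Pi (theta - eta) nu.
  by move: le; rewrite /root_le !opprB addrCA addrA.
by rewrite -(nuL _ (dot_gt0_Imin Ic (highest_split cP eP cE)) leC) opprB subrKC.
Qed.

End Extremal.
End SimpleRootlet.

(** Otherwise the system would split into [theta], its opposite, and the roots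
    orthogonal to [theta]; irreducibility leaves rank one. *)
Lemma exists_H_neq_highest : is_irreducible dot Delta -> (1 < n)%N ->
  exists gamma, [/\ P gamma, gamma <> theta & 0 < dot gamma theta].
Proof.
move=> [_ irr] n1; apply: contrapT => no.
have Hpos gamma : P gamma -> gamma = theta \/ dot gamma theta = 0.
  move=> gP; have [->|gt] := pselect (gamma = theta); first by left.
  right; apply/eqP; rewrite eq_le highest_dominant // andbT leNgt.
  by apply/negP => g0; apply: no; exists gamma.
pose T : set V := [set x | x = theta \/ x = - theta].
pose O : set V := [set x | Delta x /\ dot x theta = 0].
have tP := highest_pos.
have [||T0|O0] := irr T O.
- apply/seteqP; split=> x.
    by case=> [[]->|[]//]; [|apply: rootN]; exact: pos_root.
  move=> xD; have [/Hpos[->|x0]|/Hpos[xE|x0]] := pos_or_neg xD.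
  + by left; left.
  + by right.
  + by left; right; rewrite -xE opprK.
  + right; split=> //; move: x0; rewrite linearNl /= => /eqP.
    by rewrite oppr_eq0 => /eqP.
- by move=> x y [] -> [_ yt]; rewrite ?linearNl /= dotC yt ?oppr0.
- by have : T theta by [left]; rewrite T0.
have simpleE i : tnth Pi i = theta.
  case: (Hpos _ (simple_pos i)) => // it.
  suff : O (tnth Pi i) by rewrite O0.
  by split=> //; exact/pos_root/simple_pos.
pose i0 := Ordinal (ltnW n1); pose i1 := Ordinal n1.
have := coord_simple base_basis i0 i1; rewrite simpleE -(simpleE i0).
by rewrite (coord_simple base_basis) eqxx => /eqP; rewrite oner_eq0.
Qed.

End LongHighest.
End HighestRoot.
End RootSystem.

Theorem theorem0p4 (R : realType) (V : vectType R) (dot : {dot V for idfun})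
    (n : nat) (Pi : n.-tuple V) (Delta : set V) (theta : V)
    (Delta_rs : is_root_system dot Delta)
    (Delta_irr : is_irreducible dot Delta)
    (Pi_base : is_base Pi Delta)
    (theta_highest : is_highest_root Pi Delta theta)
    (alpha : V) (alpha_simple : alpha \in Pi) (alpha_long : is_long dot Delta alpha)
    (Imin Imax : set V)
    (Imin_def : unique_minimal (Ab dot Pi Delta theta alpha) Imin)
    (Imax_def : unique_maximal (Ab dot Pi Delta theta alpha) Imax) :
  let minI := min_elts Pi Imin in
  let maxC := max_elts Pi (positive_roots Pi Delta `\` Imax) in
  [/\ (1 < n)%N -> set_bij minI maxC (fun nu => theta - nu),
      (1 < n)%N -> forall nu, minI nu -> maxC (theta - nu),
      forall eta, maxC eta -> minI (theta - eta) &
      maxC `<=` Hset dot Pi Delta theta].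
Proof.
have /tnthP[j alphaE] := alpha_simple.
rewrite alphaE in alpha_long Imin_def Imax_def.
have [Imin_min Imin_unique] := Imin_def; have [Imax_max _] := Imax_def.
have theta_long gamma : Delta gamma -> dot gamma gamma <= dot theta theta.
  have [w [g [k [A _ _ gt _]]]] :=
    Ab_action Delta_rs Pi_base theta_highest Imin_min.1.
  rewrite -(act_isometry A theta theta) gt linearNl linearNr /= opprK.
  exact: alpha_long.2.
have Imin_sub : Imin `<=` Imax.
  have [J Jmin JI] := minimal_below Delta_rs Imax_max.1.
  by rewrite -(Imin_unique J Jmin).
move=> minI maxC.
have toMin eta : maxC eta -> minI (theta - eta) /\ 0 < dot eta theta.
  exact: (max_to_min Delta_rs Pi_base theta_highest theta_long
            Imin_min Imax_max Imin_sub).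
have toMax : (1 < n)%N -> forall nu, minI nu -> maxC (theta - nu).
  move=> n1 nu nu_min.
  apply: (min_to_max Delta_rs Pi_base theta_highest theta_long
            Imin_min Imax_max Imin_sub nu_min) => nut.
  (* The pair [g, theta - g] shows that [theta] is not minimal in [Imin]. *)
  have [g [gP gt g0]] :=
    exists_H_neq_highest Delta_rs Pi_base theta_highest Delta_irr n1.
  have only x : Imin x -> x = theta.
    move=> Ix; rewrite nut in nu_min; apply: nu_min.2 => //.
    by apply: theta_highest.2; exact: Ab_pos Imin_min.1 _ Ix.
  have cP := highest_sub Delta_rs theta_highest gP gt g0.
  have pairE :=
    Ab_pair Delta_rs Pi_base theta_highest Imin_min.1 gP cP (subrKC _ _).
  have [/only//|nIg] := pselect (Imin g).
  have /contrapT/only/eqP : ~ ~ Imin (theta - g) by move=> /pairE.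
  by rewrite -subr_eq0 addrAC subrr add0r oppr_eq0 => /eqP/(pos_neq0 Delta_rs gP).
split=> //; last first.
- move=> eta eta_max; have [_ /lt0r_neq0/eqP e0] := toMin _ eta_max.
  by split=> //; case: eta_max => -[].
- by move=> eta /toMin[].
move=> n1; split.
- exact: toMax.
- by move=> x y _ _ /addrI/oppr_inj.
- move=> eta eta_max; exists (theta - eta); first by case: (toMin _ eta_max).
  by rewrite opprB subrKC.
Qed.
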